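(* Suppose there is a $t$-$(\Gamma,L,1)$ design, and let $\mu\in\{\frac1\Gamma,\frac2\Gamma,\ldots,\frac{\Gamma-L}{\Gamma}\}$. Then there exists a $(K,F,Z,S)$ PDA with $$K=\frac{\binom{\Gamma}{t}}{\binom{L}{t}},\quad F=\binom{\Gamma}{\mu\Gamma}\binom{L}{t},\quad Z=\left(\binom{\Gamma}{\mu\Gamma}-\binom{\Gamma-L}{\mu\Gamma}\right)\binom{L}{t},\quad S\le\binom{\Gamma}{t+\mu\Gamma}-K\binom{L}{t+\mu\Gamma}.$$ Consequently, for the shared-link coded caching model with $K$ users and $N$ files, the memory-load point $$(M,R)=\left(N-\frac{\binom{\Gamma-L}{\mu\Gamma}N}{\binom{\Gamma}{\mu\Gamma}},\ \frac{\binom{\Gamma-\mu\Gamma}{t}}{\binom{t+\mu\Gamma}{t}\binom{L}{t}}-\frac{\binom{\Gamma}{t}\binom{L}{t+\mu\Gamma}}{\binom{\Gamma}{\mu\Gamma}\binom{L}{t}^2}\right)$$ is achievable with subpacketization $F=\binom{\Gamma}{\mu\Gamma}\binom{L}{t}$.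
   Context: Notation: $[n]=\{1,\dots,n\}$; $\binom{a}{b}=0$ if $b>a$. A $t$-$(\Gamma,L,\lambda)$ design (positive integers $t\le L\le\Gamma$) is a pair $(\mathcal{X},\mathfrak{B})$ where $\mathcal{X}$ is a set of $\Gamma$ points and $\mathfrak{B}$ is a collection of $L$-subsets of $\mathcal{X}$ (blocks) such that every $t$-subset of $\mathcal{X}$ is contained in exactly $\lambda$ blocks. A $(K,F,Z,S)$ placement delivery array (PDA) is an $F\times K$ array $\mathbf{P}$ with entries in $\{*\}\cup[S]$ such that: (C1) the symbol $*$ appears exactly $Z$ times in each column; (C2) each integer of $[S]$ occurs at least once; (C3) whenever two distinct entries satisfy $\mathbf{P}(j_1,k_1)=\mathbf{P}(j_2,k_2)=s\in[S]$, then $j_1\ne j_2$, $k_1\ne k_2$, and $\mathbf{P}(j_1,k_2)=\mathbf{P}(j_2,k_1)=*$. Shared-link coded caching model. A server with $N$ equal-length files is connected by an error-free shared link to $K\le N$ users, each having its own cache of size $M$ files. An $F$-division scheme (subpacketization $F$): each file is divided into $F$ packets of equal size; in the placement phase each user caches at most $MF$ packets without knowledge of later requests; in the delivery phase, given the request vector $\mathbf{d}\in[N]^K$, the server broadcasts $S_{\mathbf{d}}$ coded packets so that every user recovers its requested file from its cache and the broadcast. The load is $\max_{\mathbf{d}\in[N]^K}S_{\mathbf{d}}/F$. A point $(M,R)$ is achievable with subpacketization $F$ if there is an $F$-division scheme with cache size $M$ and load at most $R$. *)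

(* Defs.v *)
From mathcomp Require Import all_boot all_order all_algebra.
Set Implicit Arguments. Unset Strict Implicit. Unset Printing Implicit Defensive.
Import Order.TTheory GRing.Theory Num.Theory.
Local Open Scope nat_scope.

(* [B] is a set of blocks rather than a multiset: when lambda = 1 repeated
   blocks are impossible anyway, since every block contains a t-subset. *)
Definition is_design (t Gamma L lambda : nat) (X : finType)
    (B : {set {set X}}) : Prop :=
  [/\ 0 < t, t <= L <= Gamma, #|X| = Gamma,
      forall b, b \in B -> #|b| = L
    & forall T : {set X}, #|T| = t -> #|[set b in B | T \subset b]| = lambda].

(* [None] is the symbol *, and [Some s] with s : 'I_S stands for s + 1 in
   {1, ..., S}; rows and columns are likewise indexed from 0. *)
Definition is_PDA (K F Z S : nat) (P : 'M[option 'I_S]_(F, K)) : Prop :=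
  [/\ forall k : 'I_K, #|[set j : 'I_F | P j k == None]| = Z,
      forall s : 'I_S, exists j k, P j k = Some s
    & forall (s : 'I_S) (j1 j2 : 'I_F) (k1 k2 : 'I_K),
        (j1, k1) <> (j2, k2) -> P j1 k1 = Some s -> P j2 k2 = Some s ->
        [/\ j1 <> j2, k1 <> k2, P j1 k2 = None & P j2 k1 = None]].

Definition packet (ell : nat) := 'rV['F_2]_ell.

Definition file (F ell : nat) := {ffun 'I_F -> packet ell}.

Definition library (N F ell : nat) := {ffun 'I_N -> file F ell}.

Definition request (N K : nat) := {ffun 'I_K -> 'I_N}.

Definition cache (N F ell : nat) := {ffun 'I_N * 'I_F -> option (packet ell)}.

(* The pair (n, j) denotes the j-th packet of the n-th file. *)
Definition cached (N F ell : nat) (C : {set 'I_N * 'I_F})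
    (W : library N F ell) : cache N F ell :=
  [ffun p => if p \in C then Some (W p.1 p.2) else None].

(* The placement is fixed before the request vector is known, and neither it
   nor the number of transmissions depends on the packet length ell; a coded
   packet is an arbitrary packet-valued function of the library. *)
Record scheme (N K F : nat) := Scheme {
  placement : 'I_K -> {set 'I_N * 'I_F};
  transmissions : request N K -> nat;
  encode : forall (ell : nat) (d : request N K),
    library N F ell -> (transmissions d).-tuple (packet ell);
  decode : forall (ell : nat) (d : request N K) (k : 'I_K),
    cache N F ell -> (transmissions d).-tuple (packet ell) -> file F ell;
  decodeP : forall (ell : nat) (d : request N K) (k : 'I_K)
      (W : library N F ell),
    decode k (cached (placement k) W) (encode d W) = W (d k) }.

Local Open Scope ring_scope.

Definition fits_cache (N K F : nat) (sc : scheme N K F) (M : rat) : Prop :=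
  forall k : 'I_K, #|placement sc k|%:R <= M * F%:R.

Definition load (N K F : nat) (sc : scheme N K F) : rat :=
  (\max_(d : request N K) transmissions sc d)%:R / F%:R.

Definition achievable (N K F : nat) (M R : rat) : Prop :=
  (0 < F)%N /\ exists sc : scheme N K F, fits_cache sc M /\ load sc <= R.

(* Main.v *)
Require Import Defs.
From mathcomp Require Import all_boot all_order all_algebra.
From mathcomp Require Import ring.
Set Implicit Arguments. Unset Strict Implicit. Unset Printing Implicit Defensive.
Import Order.TTheory GRing.Theory Num.Theory.
Local Open Scope ring_scope.

(** Columns are the blocks, rows are the pairs of an m-subset A and an index
    i < C(L, t). The entry at ((A, i), b) is * when A meets b, and otherwise the
    set D = A :|: T, where T is the i-th t-subset of b. Then T = D :&: b and
    A = D :\: b, so D occurs at most once in each column. If D occurs in columns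
    b1 <> b2, then D :\: b1 meets b2, since otherwise the t-set D :&: b2 would
    lie in both blocks. For the same reason no D that occurs is contained in a
    block; the (t + m)-sets that are contained in a block number
    K C(L, t + m). For the delivery, the packets at the positions of each symbol
    are summed. *)

(** * Counting identities, and arrays indexed by finite types *)

(** Both sides count the pairs of disjoint subsets of an n-set with m and t elements. *)
Lemma bin_mul_bin (n m t : nat) :
  ('C(n, m) * 'C(n - m, t) = 'C(n, t + m) * 'C(t + m, t))%N.
Proof.
have [tmn | ntm] := leqP (t + m) n; last first.
  rewrite (bin_small ntm) mul0n; have [mn | nm] := leqP m n.
    by rewrite ['C(n - m, t)]bin_small ?muln0 // ltn_subLR // addnC.
  by rewrite bin_small.
have mn : (m <= n)%N by apply: leq_trans tmn; apply: leq_addl.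
have tnm : (t <= n - m)%N by rewrite leq_subRL // addnC.
apply/eqP; rewrite -(eqn_pmul2r (fact_gt0 m)) -(eqn_pmul2r (fact_gt0 t)).
rewrite -(eqn_pmul2r (fact_gt0 (n - (t + m)))); apply/eqP.
have h1 := bin_fact mn; have h2 := bin_fact tnm; have h3 := bin_fact tmn.
have h4 := bin_fact (leq_addr m t); rewrite addKn in h4.
rewrite -subnDA [(m + t)%N]addnC in h2.
transitivity n`!.
  by rewrite -h1 -h2; ring.
by rewrite -h3 -h4; ring.
Qed.

(** Double counting of the pairs of a block and an s-subset of it; needed for s = t and for s = t +
    m. *)
Lemma sum_card_containing (X : finType) (B : {set {set X}}) (L s : nat) :
  (forall b, b \in B -> #|b| = L) ->
  (\sum_(T : {set X} | #|T| == s) #|[set b in B | T \subset b]|)%N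
    = (#|B| * 'C(L, s))%N.
Proof.
move=> hL.
under eq_bigr => T _ do (rewrite -sum1dep_card big_mkcondr /=).
rewrite exchange_big /= -sum_nat_const; apply: eq_bigr => b bB.
rewrite -(hL b bB) -cards_draws -sum1dep_card -big_mkcondr /=.
by apply: eq_bigl => T; rewrite andbC.
Qed.

(** Taking the range of [f] as alphabet makes (C2) automatic. One star of (C3) suffices as
    hypothesis: exchanging the two cells gives the other. *)
Lemma PDA_of_fun (R C D : finType) (f : R -> C -> option D) (F K Z : nat) :
  #|R| = F -> #|C| = K ->
  (forall c, #|[set r | f r c == None]| = Z) ->
  (forall d r1 r2 c1 c2, f r1 c1 = Some d -> f r2 c2 = Some d ->
     (r1, c1) <> (r2, c2) -> f r1 c2 = None) ->
  exists P : 'M[option 'I_#|[set d | [exists r, exists c, f r c == Some d]]|]_(F, K),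
    is_PDA Z P.
Proof.
move=> <- <- hZ hf; set U := finset _.
pose P : 'M[option 'I_#|U|]_(#|R|, #|C|) :=
  \matrix_(j, k) [pick s | f (enum_val j) (enum_val k) == Some (enum_val s)].
have PS j k s : P j k = Some s <-> f (enum_val j) (enum_val k) = Some (enum_val s).
  rewrite mxE; case: pickP => [s' /eqP -> | none]; split => //.
  - by case=> ->.
  - by case=> /enum_val_inj ->.
  - by move=> e; move: (none s); rewrite e eqxx.
have PN j k : P j k = None <-> f (enum_val j) (enum_val k) = None.
  rewrite mxE; case: pickP => [s' /eqP -> | none]; split => //.
  case e: (f _ _) => [d|] // _.
  have dU : d \in U.
    by rewrite inE; apply/existsP; exists (enum_val j); apply/existsP;
       exists (enum_val k); rewrite e.
  by move: (none (enum_rank_in dU d)); rewrite enum_rankK_in // e eqxx.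
exists P; split.
- move=> k; rewrite -(hZ (enum_val k)) -(card_imset _ (@enum_val_inj R R)).
  apply: eq_card => r; rewrite !inE; apply/imsetP/eqP.
    by case=> j; rewrite inE => /eqP/PN h ->.
  move=> h; exists (enum_rank r); rewrite ?enum_rankK // inE.
  by apply/eqP/PN; rewrite enum_rankK.
- move=> s; have := enum_valP s; rewrite inE => /existsP[r /existsP[c /eqP e]].
  exists (enum_rank r), (enum_rank c); apply/PS.
  by rewrite !enum_rankK.
move=> s j1 j2 k1 k2 ne e1 e2.
have ne' : (enum_val j1, enum_val k1) <> (enum_val j2, enum_val k2).
  by case=> /enum_val_inj h1 /enum_val_inj h2; apply: ne; rewrite h1 h2.
have e12 : P j1 k2 = None.
  by exact/PN/(hf _ _ _ _ _ (iffLR (PS _ _ _) e1) (iffLR (PS _ _ _) e2) ne').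
have e21 : P j2 k1 = None.
  apply/PN; apply: (hf _ _ _ _ _ (iffLR (PS _ _ _) e2) (iffLR (PS _ _ _) e1)).
  by move=> h; apply: ne'; rewrite h.
(* In a common row or column, the cell [(j1, k2)] would be one of the two given cells, hence both *
   and [s]. *)
split=> // h; subst; first by rewrite e2 in e12.
by rewrite e1 in e12.
Qed.

(** * The array of a design *)

Section DesignPDA.
Variables (t Gamma L m : nat) (X : finType) (B : {set {set X}}).
Hypotheses (hB : is_design t Gamma L 1 B) (m_gt0 : (0 < m)%N).

(** Any t-subset of [T] already determines the block, as lambda = 1. *)
Lemma block_unique (T b1 b2 : {set X}) :
  (t <= #|T|)%N -> b1 \in B -> b2 \in B -> T \subset b1 -> T \subset b2 -> b1 = b2.
Proof.
case: hB => _ _ _ _ h1 leT b1B b2B s1 s2.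
have [T' /andP[sT' /eqP cT']] : exists T' : {set X}, (T' \subset T) && (#|T'| == t).
  have : (0 < #|[set T' : {set X} | T' \subset T & #|T'| == t]|)%N.
    by rewrite cards_draws bin_gt0.
  by case/card_gt0P => T'; rewrite inE; exists T'.
have /eqP/cards1P[b hb] := h1 T' cT'.
have inb b' : b' \in B -> T \subset b' -> b' = b.
  by move=> b'B s; apply/set1P; rewrite -hb inE b'B (subset_trans sT').
by rewrite (inb b1) // (inb b2).
Qed.

Lemma card_blocks : (#|B| * 'C(L, t))%N = 'C(Gamma, t).
Proof.
case: hB => _ _ cX hL h1.
rewrite -(sum_card_containing t hL) -cX -card_draws -sum1dep_card.
by apply: eq_bigr => T /eqP /h1.
Qed.

(** The i-th t-subset of [b]. A block has exactly C(L, t) of them, so the default [set0] is not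
    reached for i < C(L, t). *)
Definition draw (b : {set X}) (i : nat) : {set X} :=
  nth set0 (enum [set T : {set X} | T \subset b & #|T| == t]) i.

Lemma drawP (b : {set X}) (i : 'I_('C(L, t))) :
  b \in B -> draw b i \subset b /\ #|draw b i| = t.
Proof.
case: hB => _ _ _ hL _ /hL bL.
have : draw b i \in [set T : {set X} | T \subset b & #|T| == t].
  by rewrite -mem_enum mem_nth // -cardE cards_draws bL.
by rewrite inE => /andP[-> /eqP].
Qed.

Lemma draw_inj (b : {set X}) : b \in B ->
  injective (fun i : 'I_('C(L, t)) => draw b i).
Proof.
case: hB => _ _ _ hL _ /hL bL i j /eqP.
rewrite nth_uniq ?enum_uniq -?cardE ?cards_draws ?bL // => /eqP.
exact: val_inj.
Qed.

Definition msubset := {A : {set X} | #|A| == m}.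
Definition block := {b : {set X} | b \in B}.

Definition entry (r : msubset * 'I_('C(L, t))) (c : block) : option {set X} :=
  if [disjoint val r.1 & val c] then Some (val r.1 :|: draw (val c) r.2)
  else None.

(** As A misses the block and T lies in it, the column and the symbol together determine the row. *)
Lemma entryP r c D : entry r c = Some D ->
  [/\ #|D| = (t + m)%N, val r.1 = D :\: val c, draw (val c) r.2 = D :&: val c
    & #|D :&: val c| = t].
Proof.
rewrite /entry; case: ifP => // dj [<-].
have [sT cT] := drawP r.2 (valP c).
set A := val r.1 in dj *; set T := draw _ _ in sT cT *.
have eT : (A :|: T) :&: val c = T.
  by rewrite setIUl (disjoint_setI0 dj) set0U; apply/setIidPl.
have eA : (A :|: T) :\: val c = A.
  rewrite setDUl (_ : T :\: val c = set0); last by apply/eqP; rewrite setD_eq0.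
  by rewrite setU0; apply/setDidPl.
rewrite eT eA cT; split=> //.
rewrite -(cardsID (val c) (A :|: T)) eT eA cT.
by rewrite (eqP (valP r.1)).
Qed.

(** An entry is not * when A lies in the complement of the block, which has Gamma - L points; the
    index i is free. *)
Lemma card_stars (c : block) :
  #|[set r | entry r c == None]|
    = (('C(Gamma, m) - 'C(Gamma - L, m)) * 'C(L, t))%N.
Proof.
case: (hB) => _ _ cX hL _.
pose M := [set A : msubset | ~~ [disjoint val A & val c]].
have -> : [set r | entry r c == None] = setX M [set: 'I_('C(L, t))].
  by apply/setP => r; rewrite !inE andbT /entry; case: ifP.
rewrite cardsX cardsT card_ord; congr (_ * _)%N.
have cM : #|{: msubset}| = 'C(Gamma, m).
  by rewrite card_sig -cX -card_draws cardsE.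
have cMC : #|~: M| = 'C(Gamma - L, m).
  have -> : (Gamma - L)%N = #|~: val c|.
    by rewrite -(hL _ (valP c)) -cX -(cardsC (val c)) addKn.
  rewrite -cards_draws -(card_imset _ val_inj); apply: eq_card => A.
  rewrite inE; apply/imsetP/andP.
    case=> A' + ->; rewrite !inE negbK => dj.
    by rewrite -disjoints_subset dj (valP A').
  case=> dj cA; exists (Sub A cA); last by rewrite SubK.
  by rewrite !inE negbK /= disjoints_subset.
by rewrite -cM -cMC -(cardsC M) addnK.
Qed.

Lemma entry_cross D r1 r2 c1 c2 :
  entry r1 c1 = Some D -> entry r2 c2 = Some D -> (r1, c1) <> (r2, c2) ->
  entry r1 c2 = None.
Proof.
move=> /entryP[_ A1 T1 _] /entryP[_ A2 T2 t2] ne.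
rewrite /entry; case: ifP => // dj; case: ne.
(* If the cross entry is not *, then [D :\: val c1] misses [val c2], so the t-set [D :&: val c2]
   lies in both blocks. *)
have cc : c1 = c2.
  apply/val_inj/(@block_unique (D :&: val c2)); rewrite ?t2 ?subsetIr //.
  - exact: valP.
  - exact: valP.
  apply/subsetP => x /setIP[xD x2]; apply/negP => /negP x1.
  by move: (disjointFl dj x2); rewrite A1 inE xD x1.
subst c2; congr (_, _).
case: r1 r2 A1 T1 A2 T2 {dj} => [a1 i1] [a2 i2] /= A1 T1 A2 T2.
congr (_, _); first exact/val_inj/(etrans A1).
exact/(draw_inj (valP c1))/(etrans T1).
Qed.

(** Both terms are sums over the (t + m)-sets D, and each D contributes at most 1 in total: it lies
    in at most one block, and in none if it is a symbol. *)
Lemma card_symbols :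
  (#|[set D | [exists r, exists c, entry r c == Some D]]|
     + #|B| * 'C(L, t + m) <= 'C(Gamma, t + m))%N.
Proof.
case: (hB) => _ _ cX hL _; set U := finset _.
have Ucard D : D \in U -> #|D| == (t + m)%N.
  by rewrite inE => /existsP[r /existsP[c /eqP/entryP[->]]].
rewrite -(sum_card_containing _ hL) -sum1_card.
rewrite (eq_bigl (fun D : {set X} => (#|D| == (t + m)%N) && (D \in U))); last first.
  by move=> D; case: (boolP (D \in U)) => [/Ucard -> // | _]; rewrite andbF.
rewrite big_mkcondr -big_split /= -cX -card_draws -sum1dep_card.
apply: leq_sum => D /eqP cD.
have tD : (t <= #|D|)%N by rewrite cD leq_addr.
case: ifP => [|_]; last first.
  rewrite add0n; apply/card_le1P => b; rewrite inE => /andP[bB Db] b'.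
  rewrite !inE; apply/andP/eqP => [[b'B Db']|-> //].
  exact: (block_unique tD).
rewrite inE => /existsP[r /existsP[c /eqP/entryP[_ _ _ ct]]].
rewrite [X in (_ + X)%N]eq_card0 // => b; rewrite !inE; apply/negP => /andP[bB Db].
(* A block containing the symbol D shares the t-set [D :&: val c] with [val c], so it equals
   [val c]; then D itself would have only t elements, against m > 0. *)
have bc : b = val c.
  apply: (@block_unique (D :&: val c)) => //; rewrite ?ct ?subsetIr //.
    exact: valP.
  exact: subset_trans (subsetIl _ _) Db.
move: ct; rewrite -bc (setIidPl Db) cD => /eqP.
by rewrite -{2}[t]addn0 eqn_add2l -leqn0 leqNgt m_gt0.
Qed.

Lemma design_PDA :
  exists S (P : 'M[option 'I_S]_('C(Gamma, m) * 'C(L, t), #|B|)),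
    is_PDA (('C(Gamma, m) - 'C(Gamma - L, m)) * 'C(L, t)) P
    /\ (S + #|B| * 'C(L, t + m) <= 'C(Gamma, t + m))%N.
Proof.
case: (hB) => _ _ cX _ _.
have cR : #|{: msubset * 'I_('C(L, t))}| = ('C(Gamma, m) * 'C(L, t))%N.
  by rewrite card_prod card_ord card_sig -cX -card_draws cardsE.
have cC : #|{: block}| = #|B| by rewrite card_sig; apply: eq_card.
have [P hP] := PDA_of_fun cR cC card_stars entry_cross.
by eexists; exists P; split; [exact: hP | exact: card_symbols].
Qed.

End DesignPDA.

(** * From a PDA to a coded caching scheme *)

Section SchemeOfPDA.
Variables (N K F Z S : nat) (P : 'M[option 'I_S]_(F, K)).
Hypothesis hP : is_PDA Z P.

Definition pda_placement (k : 'I_K) : {set 'I_N * 'I_F} :=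
  [set p | P p.2 k == None].

Definition pda_encode ell (d : request N K) (W : library N F ell) :
    S.-tuple (packet ell) :=
  [tuple \sum_(q : 'I_F * 'I_K | P q.1 q.2 == Some s) W (d q.2) q.1 | s < S].

Definition pda_decode ell (d : request N K) (k : 'I_K) (C : cache N F ell)
    (Y : S.-tuple (packet ell)) : file F ell :=
  [ffun j => if P j k is Some s then
      tnth Y s - \sum_(q : 'I_F * 'I_K | (P q.1 q.2 == Some s) && (q != (j, k)))
                   odflt 0 (C (d q.2, q.1))
    else odflt 0 (C (d k, j))].

Lemma pda_decodeP ell (d : request N K) (k : 'I_K) (W : library N F ell) :
  pda_decode d k (cached (pda_placement k) W) (pda_encode d W) = W (d k).
Proof.
case: hP => _ _ C3; apply/ffunP => j; rewrite ffunE.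
case e: (P j k) => [s|]; last by rewrite ffunE inE /= e eqxx.
rewrite tnth_mktuple (bigD1 (j, k)) /= ?e //.
rewrite [X in _ - X](eq_bigr (fun q => W (d q.2) q.1)) ?addrK //.
move=> [j' k'] /= /andP[/eqP e' /eqP ne].
by have [_ _ e'' _] := C3 s j' j k' k ne e' e; rewrite ffunE inE /= e'' eqxx.
Qed.

(** Each user stores Z packets of every file, and every request takes S transmissions. *)
Lemma PDA_achievable (M R : rat) :
  (0 < F)%N -> (N * Z)%:R <= M * F%:R -> S%:R / F%:R <= R ->
  achievable N K F M R.
Proof.
move=> F_gt0 hM hR; split=> //.
exists (@Scheme N K F pda_placement (fun=> S) pda_encode pda_decode pda_decodeP).
split.
  move=> k; apply: le_trans hM; rewrite ler_nat /=.
  have -> : pda_placement k = setX setT [set j | P j k == None].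
    by apply/setP => p; rewrite !inE.
  by case: hP => cZ _ _; rewrite cardsX cardsT card_ord cZ.
apply: le_trans hR; rewrite ler_pM2r ?invr_gt0 ?ltr0n // ler_nat.
exact/bigmax_leqP.
Qed.

End SchemeOfPDA.

Theorem corollary1 (t Gamma L : nat) (X : finType) (B : {set {set X}})
    (hB : is_design t Gamma L 1 B)
    (mu : rat) (hmu : mu \in [seq i%:R / Gamma%:R | i <- iota 1 (Gamma - L)])
    (m : nat) (hm : m%:R = mu * Gamma%:R) :
  let F := ('C(Gamma, m) * 'C(L, t))%N in
  let Z := (('C(Gamma, m) - 'C(Gamma - L, m)) * 'C(L, t))%N in
  exists K : nat,
    [/\ K%:R = 'C(Gamma, t)%:R / 'C(L, t)%:R :> rat,
        exists (S : nat) (P : 'M[option 'I_S]_(F, K)),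
          is_PDA Z P /\
          S%:R <= 'C(Gamma, t + m)%:R - K%:R * 'C(L, t + m)%:R :> rat
      & forall N : nat, (K <= N)%N ->
          achievable N K F
            (N%:R - 'C(Gamma - L, m)%:R * N%:R / 'C(Gamma, m)%:R)
            ('C(Gamma - m, t)%:R / ('C(t + m, t)%:R * 'C(L, t)%:R)
             - 'C(Gamma, t)%:R * 'C(L, t + m)%:R
               / ('C(Gamma, m)%:R * 'C(L, t)%:R ^+ 2))].
Proof.
move=> F Z; case: (hB) => _ /andP[tL LG] _ _ _.
(* Membership gives mu = i / Gamma with 1 <= i <= Gamma - L, and then m = i. *)
have [m_gt0 mG] : (0 < m)%N /\ (m <= Gamma - L)%N.
  case/mapP: hmu => i; rewrite mem_iota add1n ltnS => /andP[i_gt0 iG] e.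
  have G0 : Gamma%:R != 0 :> rat.
    by rewrite pnatr_eq0 -lt0n (leq_trans i_gt0) // (leq_trans iG) ?leq_subr.
  by move/eqP: hm; rewrite e divfK // eqr_nat => /eqP ->.
have mG' : (m <= Gamma)%N by rewrite (leq_trans mG) ?leq_subr.
have c0 : 'C(L, t)%:R != 0 :> rat by rewrite pnatr_eq0 -lt0n bin_gt0.
have g0 : 'C(Gamma, m)%:R != 0 :> rat by rewrite pnatr_eq0 -lt0n bin_gt0.
have a0 : 'C(t + m, t)%:R != 0 :> rat by rewrite pnatr_eq0 -lt0n bin_gt0 leq_addr.
have F_gt0 : (0 < F)%N by rewrite muln_gt0 !bin_gt0 mG'.
have eK : #|B|%:R = 'C(Gamma, t)%:R / 'C(L, t)%:R :> rat.
  by rewrite -(card_blocks hB) natrM mulfK.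
have [S [P [hP hS]]] := design_PDA hB m_gt0.
have hS' : S%:R <= 'C(Gamma, t + m)%:R - #|B|%:R * 'C(L, t + m)%:R :> rat.
  by rewrite lerBrDr -natrM -natrD ler_nat.
exists #|B|; split=> //; first by exists S, P.
move=> N _; apply: (PDA_achievable hP) => //.
  (* The memory bound holds with equality: N Z = M F. *)
  rewrite /Z /F !natrM natrB ?leq_bin2l ?leq_subr //.
  by rewrite le_eqVlt; apply/orP; left; apply/eqP; field.
have trinomial : 'C(Gamma, m)%:R * 'C(Gamma - m, t)%:R
    = 'C(Gamma, t + m)%:R * 'C(t + m, t)%:R :> rat.
  by rewrite -!natrM bin_mul_bin.
(* The upper bound on S is exactly R F: [trinomial] turns the first term of R F into C(Gamma, t +
   m), and [eK] matches the second. *)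
rewrite ler_pdivrMr ?ltr0n //; apply: le_trans hS' _.
rewrite le_eqVlt; apply/orP; left; apply/eqP.
rewrite eK /F natrM.
have -> : 'C(Gamma - m, t)%:R
    = 'C(Gamma, t + m)%:R * 'C(t + m, t)%:R / 'C(Gamma, m)%:R :> rat.
  by rewrite -trinomial mulrC mulKf.
by field; rewrite a0 c0 g0.
Qed.
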